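(* Let $m,n,r$ be positive integers and let $(A,B)$ be a size-$r$ nonnegative factorization, where $A\in\mathbb{R}^{m\times r}_{\ge 0}$, $B\in\mathbb{R}^{r\times n}_{\ge 0}$ and $\operatorname{rank}(AB)=r$. If $(A,B)$ is locally rigid but not infinitesimally rigid, then $$\operatorname{K\text{-}rank}(Z_{(A,B)})<\min(c,r^2-r),$$ where $c$ is the number of columns of the matrix $Z_{(A,B)}$.
   Context: Inequalities between matrices are entrywise. An infinitesimal motion of $(A,B)$ is a pair $(\dot A,\dot B)\in\mathbb{R}^{m\times r}\times\mathbb{R}^{r\times n}$ with $A\dot B+\dot A B=0$ such that for some $\epsilon>0$ one has $A+t\dot A\ge 0$ and $B+t\dot B\ge 0$ for all $t\in[0,\epsilon)$. The motion is trivial if $\dot A=AD$ and $\dot B=-DB$ for some diagonal $D\in\mathbb{R}^{r\times r}$. The factorization $(A,B)$ is infinitesimally rigid if all of its infinitesimal motions are trivial. The factorization $(A,B)$ is locally rigid if there is a neighborhood of $(A,B)$ in $\mathbb{R}^{m\times r}\times\mathbb{R}^{r\times n}$ such that every size-$r$ nonnegative factorization of $AB$ in that neighborhood (pair of nonnegative matrices $(\tilde A,\tilde B)$ with $\tilde A\tilde B=AB$) is of the form $(A\Lambda,\Lambda^{-1}B)$ for a diagonal matrix $\Lambda$ with positive diagonal entries. Let $a_1^T,\dots,a_m^T$ be the rows of $A$ and $b_1,\dots,b_n$ the columns of $B$; let $S_i$, resp. $T_i$, $\subseteq\{1,\dots,r\}$ be the set of positions of zero entries of $a_i$, resp. $b_i$;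 let $\mathcal{A}_i=\{a_ie_j^T : j\in S_i\}$ and $\mathcal{B}_i=\{-e_jb_i^T : j\in T_i\}$. $Z_{(A,B)}$ is the matrix whose columns are the elements of $\mathcal{A}_1\cup\dots\cup\mathcal{A}_m\cup\mathcal{B}_1\cup\dots\cup\mathcal{B}_n$, regarded as vectors in $\mathbb{R}^{r^2}$. The Kruskal rank $\operatorname{K\text{-}rank}(Z)$ of a matrix $Z$ is the maximal $k$ such that any $k$ columns of $Z$ are linearly independent. *)

(* Defs.v *)
From HB Require Import structures.
From mathcomp Require Import all_boot all_order all_algebra.
From mathcomp Require Import all_classical all_reals all_analysis.
Import Order.TTheory GRing.Theory Num.Theory.
Import numFieldNormedType.Exports.

Set Implicit Arguments.
Unset Strict Implicit.
Unset Printing Implicit Defensive.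

Local Open Scope ring_scope.

Section NonnegativeFactorization.
Variables (R : realType) (m n r : nat).
Implicit Types (A dA : 'M[R]_(m, r)) (B dB : 'M[R]_(r, n)).

Definition nn_factorization (X : 'M[R]_(m, n)) A B : Prop :=
  [/\ A \is a mxOver Num.nneg, B \is a mxOver Num.nneg & A *m B = X].

Definition infinitesimal_motion A B dA dB : Prop :=
  A *m dB + dA *m B = 0 /\
  exists2 eps : R, 0 < eps & forall t : R, 0 <= t < eps ->
    A + t *: dA \is a mxOver Num.nneg /\ B + t *: dB \is a mxOver Num.nneg.

Definition trivial_motion A B dA dB : Prop :=
  exists D : 'M[R]_r, [/\ is_diag_mx D, dA = A *m D & dB = - D *m B].

Definition infinitesimally_rigid A B : Prop :=
  forall dA dB, infinitesimal_motion A B dA dB -> trivial_motion A B dA dB.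

Definition locally_rigid A B : Prop :=
  \forall AB' \near (A, B), nn_factorization (A *m B) AB'.1 AB'.2 ->
    exists L : 'M[R]_r, [/\ is_diag_mx L, forall i, 0 < L i i,
      AB'.1 = A *m L & AB'.2 = invmx L *m B].

(* The [r x r] matrices [a_i e_j^T] with [j] a zero position of the row [a_i]
   of [A]. *)
Definition row_zero_mxs A (i : 'I_m) : seq 'M[R]_r :=
  [seq (row i A)^T *m delta_mx (0 : 'I_1) j | j <- enum 'I_r & A i j == 0].

(* The [r x r] matrices [- e_j b_i^T] with [j] a zero position of the column
   [b_i] of [B]. *)
Definition col_zero_mxs B (i : 'I_n) : seq 'M[R]_r :=
  [seq - (delta_mx j (0 : 'I_1) *m (col i B)^T) | j <- enum 'I_r & B j i == 0].

(* [undup], because the columns of Z are the elements of a union of sets: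
   a matrix that arises several times contributes a single column. *)
Definition Z_elems A B : seq 'M[R]_r :=
  undup (flatten [seq row_zero_mxs A i | i <- enum 'I_m] ++
         flatten [seq col_zero_mxs B i | i <- enum 'I_n]).

Definition Z_mx A B : 'M[R]_(r * r, size (Z_elems A B)) :=
  \matrix_(k, l) mxvec (nth 0 (Z_elems A B) l) 0 k.

End NonnegativeFactorization.

(* Bounding [k] by the number [c] of columns is needed: for [k > c] the
   condition holds vacuously. *)
Definition Kruskal_rank (R : realType) (p c : nat) (Z : 'M[R]_(p, c)) : nat :=
  \max_(k < c.+1 | [forall J : {set 'I_c},
                     (#|J| == k) ==> free [seq col j Z | j <- enum J]]) k.

(* Main.v *)
Require Import Defs.
From HB Require Import structures.
From mathcomp Require Import all_boot all_order all_algebra.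
From mathcomp Require Import zify.
From mathcomp Require Import all_classical all_reals all_analysis.
Import Order.TTheory GRing.Theory Num.Theory.
Import numFieldNormedType.Exports.
Set Implicit Arguments.
Unset Strict Implicit.
Unset Printing Implicit Defensive.
Local Open Scope ring_scope.

(** Since [A *m B] has rank [r], [A] has a left inverse and [B] a right inverse,
so the infinitesimal motions of [(A, B)] are of the form [(A *m D, - D *m B)]
([motion_mulmx]).  The columns of [Z_mx A B], paired with [D], are exactly the
first order variations of the zero entries of [A] and [B]; hence such a pair is
a motion if and only if [D] pairs nonnegatively with every column, and it is
trivial if and only if [D] is diagonal.  Diagonal matrices pair to zero with
every column ([Z_mx_diag]), so the columns live in the space of dimension
[r ^ 2 - r] of matrices with zero diagonal.

Let [D] be a non-diagonal matrix given by a nontrivial motion.  The columns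
orthogonal to [D] lie in a space of dimension [r ^ 2 - r - 1]
([card_free_orthogonal]), so [r ^ 2 - r] of them are never independent.
If the Kruskal rank were at least [minn c (r ^ 2 - r)], with [c] the number of
columns, all columns orthogonal to [D] would therefore be jointly independent
([free_zero_forms]).  One can then prescribe the value 1 on all of
them, and moving [D] slightly in that direction makes every pairing strictly
positive ([perturb_positive]).

Once all pairings with [D] are strictly positive, the curve
[(A *m (1 + t D), (1 + t D)^-1 *m B)] consists of factorizations of [A *m B]
which are nonnegative for small [t > 0]: the zero entries increase at first
order, the other ones stay positive by continuity.  It tends to [(A, B)] and is
not a rescaling of it, as [D] is not diagonal; this contradicts local rigidity
([positive_form_not_locally_rigid]). *)

(** * Continuity of matrix operations *)

Section MatrixLimits.
Local Open Scope classical_set_scope.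
Variables (R : realType) (T : Type) (F : set_system T).
Context {FF : Filter F}.

Lemma cvg_entries m n (f : T -> 'M[R]_(m, n)) (M : 'M[R]_(m, n)) :
  (forall i j, f x i j @[x --> F] --> M i j) -> f x @[x --> F] --> M.
Proof.
move=> fM U [P nbhsP subU].
have nearP : \forall x \near F, forall i j, P i j (f x i j).
  apply: filter_forall => i; apply: filter_forall => j; apply: fM.
  exact: nbhsP.
by apply: filterS nearP => x Px; apply: subU.
Qed.

Lemma cvg_entry m n (f : T -> 'M[R]_(m, n)) (M : 'M[R]_(m, n)) i j :
  f x @[x --> F] --> M -> f x i j @[x --> F] --> M i j.
Proof.
move=> fM; apply: (cvg_comp f (fun N : 'M[R]_(m, n) => N i j) fM).
exact: coord_continuous.
Qed.

Lemma cvg_mulmx m n p (f : T -> 'M[R]_(m, n)) (g : T -> 'M[R]_(n, p))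
    (M : 'M[R]_(m, n)) (N : 'M[R]_(n, p)) :
  f x @[x --> F] --> M -> g x @[x --> F] --> N ->
  f x *m g x @[x --> F] --> M *m N.
Proof.
move=> fM gN; apply: cvg_entries => i j; rewrite mxE.
under eq_cvg do rewrite mxE.
apply: cvg_big => [|k _]; first exact: add_continuous.
by apply: cvgM; exact: cvg_entry.
Qed.

Lemma cvg_det n (f : T -> 'M[R]_n) (M : 'M[R]_n) :
  f x @[x --> F] --> M -> \det (f x) @[x --> F] --> \det M.
Proof.
move=> fM; rewrite /determinant.
apply: cvg_big => [|s _]; first exact: add_continuous.
apply: cvgM; first exact: cvg_cst.
apply: cvg_big => [|i _]; first exact: mul_continuous.
exact: cvg_entry.
Qed.

Lemma cvg_adj n (f : T -> 'M[R]_n) (M : 'M[R]_n) :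
  f x @[x --> F] --> M -> \adj (f x) @[x --> F] --> \adj M.
Proof.
move=> fM; apply: cvg_entries => i j; rewrite mxE.
under eq_cvg do rewrite mxE.
apply: cvgM; first exact: cvg_cst.
apply: cvg_det; apply: cvg_entries => k l; rewrite !mxE.
by under eq_cvg do rewrite !mxE; exact: cvg_entry.
Qed.

Lemma near_unitmx n (f : T -> 'M[R]_n) (M : 'M[R]_n) :
  M \in unitmx -> f x @[x --> F] --> M -> \forall x \near F, f x \in unitmx.
Proof.
rewrite unitmxE unitfE => detM /cvg_det cvg_f.
by apply: filterS (cvgr_neq0 _ cvg_f detM) => x; rewrite unitmxE unitfE.
Qed.

(** By Cramer's rule the inverse is a continuous expression in the entries, but
only where the determinant does not vanish, hence only eventually. *)
Lemma cvg_invmx n (f : T -> 'M[R]_n) (M : 'M[R]_n) :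
  M \in unitmx -> f x @[x --> F] --> M -> invmx (f x) @[x --> F] --> invmx M.
Proof.
move=> uM fM.
have cramer : {near F, (fun x => (\det (f x))^-1 *: \adj (f x)) =1
                       (fun x => invmx (f x))}.
  by apply: filterS (near_unitmx uM fM) => x ux; rewrite /invmx ux.
apply: cvg_trans (near_eq_cvg cramer) _; rewrite /invmx uM.
apply: cvg_entries => i j; rewrite mxE; under eq_cvg do rewrite mxE.
apply: cvgM; last by apply: cvg_entry; exact: cvg_adj.
by apply: cvgV (cvg_det fM); rewrite -unitfE -unitmxE.
Qed.

End MatrixLimits.

Lemma cvg_affine_right0 (R : realType) (a b : R) :
  (a + t * b @[t --> 0^'+] --> a)%classic.
Proof.
have cvg_ab : (a + t * b @[t --> 0^'+] --> a + 0 * b)%classic.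
  apply: cvgD; first exact: cvg_cst.
  by apply: cvgMr_tmp; apply: cvg_at_right_filter; exact: cvg_id.
by rewrite mul0r addr0 in cvg_ab.
Qed.

(** * Kruskal rank and linear independence *)

Section KruskalRank.
Variables (R : realType) (p c : nat) (Z : 'M[R]_(p, c)).
Implicit Types J K : {set 'I_c}.

Lemma free_cols_subset J K :
  J \subset K -> free [seq col j Z | j <- enum K] ->
  free [seq col j Z | j <- enum J].
Proof.
move=> JK freeK.
have permK : perm_eq (enum K) (enum J ++ enum (K :\: J)).
  apply: uniq_perm; rewrite ?enum_uniq //.
    rewrite cat_uniq !enum_uniq andbT /=; apply/hasPn => x.
    by rewrite !mem_enum inE => /andP[].
  move=> x; rewrite mem_cat !mem_enum inE.
  by have [/(fintype.subsetP JK)|] := boolP (x \in J).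
by move: freeK; rewrite (perm_free (perm_map _ permK)) map_cat => /catl_free.
Qed.

Lemma Kruskal_rank_le : (Kruskal_rank Z <= c)%N.
Proof. by apply/bigmax_leqP => k _; rewrite -ltnS. Qed.

(** The definition only speaks of sets of exactly [Kruskal_rank Z] columns;
since [Kruskal_rank Z <= c], a smaller set extends to one of that size. *)
Lemma Kruskal_rank_free J :
  (#|J| <= Kruskal_rank Z)%N -> free [seq col j Z | j <- enum J].
Proof.
have maximal K : #|K| = Kruskal_rank Z -> free [seq col j Z | j <- enum K].
  have [|k /forallP kfree Kk] := @eq_bigmax_cond _
      [pred k : 'I_c.+1 | [forall L : {set 'I_c},
         (#|L| == k) ==> free [seq col j Z | j <- enum L]]] (@nat_of_ord _).
    apply/card_gt0P; exists ord0; rewrite inE /=; apply/forallP => L.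
    by apply/implyP; rewrite cards_eq0 => /eqP ->; rewrite enum_set0 nil_free.
  by rewrite /Kruskal_rank Kk => /eqP; exact/implyP/kfree.
(* Columns are added one at a time, until the maximal size is reached. *)
move def_d : (Kruskal_rank Z - #|J|)%N => d.
elim: d J def_d => [|d IHd] J def_d leJ.
  by apply: maximal; apply/eqP; rewrite eqn_leq leJ /= -subn_eq0 def_d.
have ltJ : (#|J| < Kruskal_rank Z)%N by rewrite -subn_gt0 def_d.
have /set0Pn[x] : ~: J != finset.set0.
  rewrite -card_gt0 cardsCs finset.setCK card_ord subn_gt0.
  exact: leq_trans ltJ Kruskal_rank_le.
rewrite inE => xJ; apply: (@free_cols_subset _ (x |: J)).
  exact: finset.subsetUr.
by apply: IHd; rewrite cardsU1 xJ //= add1n subnS def_d.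
Qed.

(** The selected columns become rows, because [row_free] is about row spaces. *)
Definition cols_mx J : 'M[R]_(#|J|, p) :=
  \matrix_(i, k) Z k (enum_val i).

Lemma cols_mx_free J :
  free [seq col j Z | j <- enum J] -> row_free (cols_mx J).
Proof.
set s := map _ _ => freeJ; apply: inj_row_free => v v0.
have sz : size s == #|J| by rewrite size_map -cardE.
have freet : free (Tuple sz) by [].
apply/rowP => i; rewrite mxE; move: i; move/freeP: freet; apply.
apply/colP => k; move/rowP: v0 => /(_ k); rewrite !mxE => v0.
rewrite -[RHS]v0 summxE; apply: eq_bigr => i _; rewrite !mxE /=.
have lti : (i < size (enum J))%N by rewrite -cardE.
rewrite (nth_map (enum_val i)) // mxE; congr (_ * Z _ _).
by rewrite /enum_val; exact: set_nth_default.
Qed.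

Lemma solve_on_free_cols J :
  free [seq col j Z | j <- enum J] ->
  exists e : 'rV[R]_p, forall j, j \in J -> (e *m Z) 0 j = 1.
Proof.
move=> /cols_mx_free/row_freeP[N cN].
exists ((N *m const_mx 1)^T : 'rV[R]_p) => j jJ.
have /colP/(_ (enum_rank_in jJ j)) :
    cols_mx J *m (N *m const_mx 1) = const_mx 1 :> 'cV[R]_#|J|.
  by rewrite mulmxA cN mul1mx.
move=> eq1; rewrite [RHS]mxE in eq1; rewrite -[RHS]eq1 [LHS]mxE [RHS]mxE.
apply: eq_bigr => k _.
by rewrite [cols_mx J _ _]mxE enum_rankK_in // mulrC [_^T _ _]mxE.
Qed.

End KruskalRank.

(** * Perturbation into the open cone *)

Section OpenCone.
Local Open Scope classical_set_scope.
Variables (R : realType) (p c : nat) (Z : 'M[R]_(p, c)).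

(** Along [d + s *: e], a column pairing positively with [d] keeps doing so for
small [s], and a column pairing to zero with [d] gets the value [s]. *)
Lemma perturb_positive (d : 'rV[R]_p) :
  (forall j, 0 <= (d *m Z) 0 j) ->
  free [seq col j Z | j <- enum [set j | (d *m Z) 0 j == 0]%SET] ->
  exists e : 'rV[R]_p,
    \forall s \near 0^'+, forall j, 0 < ((d + s *: e) *m Z) 0 j.
Proof.
move=> d_ge0 /solve_on_free_cols[e e1]; exists e.
apply: filter_forall => j.
have dse s : ((d + s *: e) *m Z) 0 j = (d *m Z) 0 j + s * (e *m Z) 0 j.
  by rewrite mulmxDl -scalemxAl mxE [X in _ + X]mxE.
have := d_ge0 j; rewrite le_eqVlt => /predU1P[d0|d_gt0].
  apply: filterS (nbhs_right_gt 0) => s s_gt0.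
  by rewrite dse -d0 add0r e1 ?inE -?d0 ?mulr1.
have cvg_d : ((d + s *: e) *m Z) 0 j @[s --> 0^'+] --> (d *m Z) 0 j.
  by under eq_cvg do rewrite dse; exact: cvg_affine_right0.
exact: cvgr_gt cvg_d _ d_gt0.
Qed.

End OpenCone.

(** * The matrix Z as a family of linear forms *)

Section LinearForms.
Variables (R : realType) (m n r : nat).
Implicit Types (A : 'M[R]_(m, r)) (B : 'M[R]_(r, n)) (D : 'M[R]_r).

Lemma row_zero_form A D i j :
  (mxvec ((row i A)^T *m delta_mx (0 : 'I_1) j) *m (mxvec D)^T) 0 0 =
  (A *m D) i j.
Proof. by rewrite mxvec_dotmul -row_mul trmx_delta -colE !mxE. Qed.

Lemma col_zero_form B D j i :
  (mxvec (- (delta_mx j (0 : 'I_1) *m (col i B)^T)) *m (mxvec D)^T) 0 0 =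
  - (D *m B) j i.
Proof.
rewrite linearN mulNmx mxE -[delta_mx j 0]trmxK trmx_delta mxvec_dotmul trmxK.
by rewrite colE -rowE mulmxA -row_mul -colE !mxE.
Qed.

Lemma Z_mx_form A B D l :
  (mxvec D *m Z_mx A B) 0 l =
  (mxvec (nth 0 (Z_elems A B) l) *m (mxvec D)^T) 0 0.
Proof. by rewrite !mxE; apply: eq_bigr => k _; rewrite !mxE mulrC. Qed.

(** Turns any statement about the values of [D] on the columns of [Z_mx A B]
into one about the entries of [A *m D] and [- D *m B] in the zero positions of
[A] and [B], whether or not several positions give the same column. *)
Lemma Z_mx_forms A B D (P : R -> Prop) :
  (forall l, P ((mxvec D *m Z_mx A B) 0 l)) <->
  (forall i j, A i j = 0 -> P ((A *m D) i j)) /\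
  (forall j i, B j i = 0 -> P (- (D *m B) j i)).
Proof.
split=> [PZ|[PA PB] l].
  have PZ' z : z \in Z_elems A B -> P ((mxvec z *m (mxvec D)^T) 0 0).
    move=> zZ; have ltz : (index z (Z_elems A B) < size (Z_elems A B))%N.
      by rewrite index_mem.
    by have := PZ (Ordinal ltz); rewrite Z_mx_form nth_index.
  split=> [i j Aij0|j i Bji0].
    rewrite -row_zero_form; apply: PZ'; rewrite mem_undup mem_cat.
    apply/orP; left; apply/flatten_mapP; exists i; first by rewrite mem_enum.
    by apply/mapP; exists j; rewrite // mem_filter Aij0 eqxx mem_enum.
  rewrite -col_zero_form; apply: PZ'; rewrite mem_undup mem_cat.
  apply/orP; right; apply/flatten_mapP; exists i; first by rewrite mem_enum.
  by apply/mapP; exists j; rewrite // mem_filter Bji0 eqxx mem_enum.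
rewrite Z_mx_form; have := mem_nth 0 (ltn_ord l).
rewrite mem_undup mem_cat => /orP[] /flatten_mapP[i _] /mapP[j].
  rewrite mem_filter => /andP[/eqP Aij0 _] ->.
  by rewrite row_zero_form; exact: PA.
rewrite mem_filter => /andP[/eqP Bji0 _] ->.
by rewrite col_zero_form; exact: PB.
Qed.

(** The entry [(A *m D) i j] is [A i j] times a scalar when [D] is diagonal, and
similarly for [B]: zero entries stay zero under rescaling. *)
Lemma Z_mx_diag A B D : is_diag_mx D -> mxvec D *m Z_mx A B = 0.
Proof.
move=> /is_diag_mxP D_diag; apply/rowP => l; rewrite [RHS]mxE.
move: l; apply/(Z_mx_forms A B D (fun x => x = 0)); split=> [i j Aij0|j i Bji0].
  rewrite mxE big1 // => k _.
  by have [->|/D_diag ->] := eqVneq k j; rewrite ?Aij0 ?mul0r ?mulr0.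
rewrite mxE big1 ?oppr0 // => k _.
have [->|] := eqVneq k j; first by rewrite Bji0 mulr0.
by rewrite eq_sym => /D_diag ->; rewrite mul0r.
Qed.

(** The columns in [J] are orthogonal to [D] and to the [r] diagonal matrix
units, which together are [r + 1] independent vectors in dimension [r * r]. *)
Lemma card_free_orthogonal A B D (J : {set 'I_(size (Z_elems A B))}) :
  ~~ is_diag_mx D -> free [seq col j (Z_mx A B) | j <- enum J] ->
  (forall j, j \in J -> (mxvec D *m Z_mx A B) 0 j = 0) ->
  (#|J| < r ^ 2 - r)%N.
Proof.
move=> D_ndiag /cols_mx_free freeJ DJ0.
pose U : 'M[R]_(r, r * r) := \matrix_(i < r) mxvec (delta_mx i i).
have vecU (v : 'rV[R]_r) : v *m U = mxvec (diag_mx v).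
  rewrite mulmx_sum_row diag_mx_sum_delta linear_sum.
  by apply: eq_bigr => i _; rewrite rowK linearZ.
pose N := col_mx (mxvec D) U.
have freeN : row_free N.
  apply: inj_row_free => v; rewrite -[v]hsubmxK mul_row_col vecU.
  rewrite [lsubmx v]mx11_scalar mul_scalar_mx -linearZ -linearD /=.
  move: (lsubmx v 0 0) (rsubmx v) => x w /(congr1 vec_mx).
  rewrite mxvecK linear0 => xDw.
  have x0 : x = 0.
    apply/eqP; apply: contraNT D_ndiag => x_neq0; apply/is_diag_mxP => i j ij.
    have := congr1 (fun M : 'M[R]_r => M i j) xDw; rewrite !mxE.
    have -> : (i == j) = false by exact/negbTE.
    by rewrite addr0 => /eqP; rewrite mulf_eq0 (negbTE x_neq0) => /eqP.
  have w0 : w = 0.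
    apply/rowP => i; have := congr1 (fun M : 'M[R]_r => M i i) xDw.
    by rewrite x0 !mxE eqxx mul0r add0r.
  by rewrite x0 w0 raddf0 row_mx0.
have orth : cols_mx (Z_mx A B) J *m N^T = 0.
  apply/trmx_inj; rewrite trmx_mul trmxK trmx0 mul_col_mx.
  have cols E : (forall j, j \in J -> (mxvec E *m Z_mx A B) 0 j = 0) ->
      mxvec E *m (cols_mx (Z_mx A B) J)^T = 0.
    move=> EJ; apply/rowP => i; rewrite [RHS]mxE -(EJ _ (enum_valP i)) !mxE.
    by apply: eq_bigr => k _; rewrite !mxE.
  rewrite cols //; apply/eqP; rewrite col_mx_eq0 eqxx /=.
  apply/eqP/row_matrixP => i.
  rewrite row_mul rowK row0; apply: cols => j _.
  rewrite Z_mx_diag ?mxE //; apply/is_diag_mxP => k l kl; rewrite mxE.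
  rewrite (_ : _ && _ = false) //.
  by apply: contra_neqF kl => /andP[/eqP-> /eqP->].
have := mulmx0_rank_max orth.
rewrite mxrank_tr (eqP freeJ) (eqP freeN) -mulnn.
lia.
Qed.

(** If the zero set were larger than the Kruskal rank, the latter would be
smaller than the number of columns, hence at least [r ^ 2 - r]; then
[r ^ 2 - r] independent columns would be orthogonal to [D]. *)
Lemma free_zero_forms A B D (Z := Z_mx A B) :
  ~~ is_diag_mx D ->
  (minn (size (Z_elems A B)) (r ^ 2 - r) <= Kruskal_rank Z)%N ->
  free [seq col j Z | j <- enum [set j | (mxvec D *m Z) 0 j == 0]%SET].
Proof.
move=> D_ndiag large_rank.
pose J := [set j | (mxvec D *m Z) 0 j == 0]%SET.
have J0 (K : {set 'I_(size (Z_elems A B))}) :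
    K \subset J -> forall j, j \in K -> (mxvec D *m Z) 0 j = 0.
  by move=> KJ j /(fintype.subsetP KJ); rewrite inE => /eqP.
apply: Kruskal_rank_free; rewrite leqNgt; apply/negP => gtJ.
have [K KJ cardK] : exists2 K : {set _}, K \subset J & #|K| = Kruskal_rank Z.
  have /card_geqP[t [uniq_t size_t tJ]] := ltnW gtJ.
  exists [set x in t]%SET; last by rewrite cardsE (card_uniqP uniq_t).
  by apply/fintype.subsetP => x; rewrite inE => /tJ.
have freeK : free [seq col j Z | j <- enum K].
  by apply: Kruskal_rank_free; rewrite cardK.
have := card_free_orthogonal D_ndiag freeK (J0 _ KJ); rewrite cardK ltnNge.
move/negP; apply; move: large_rank; rewrite geq_min => /orP[|//].
by rewrite leqNgt (leq_trans gtJ) // -[leqRHS]card_ord max_card.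
Qed.

End LinearForms.

(** * Motions and rigidity *)

Section Rigidity.
Local Open Scope classical_set_scope.
Variables (R : realType) (m n r : nat).
Implicit Types (A : 'M[R]_(m, r)) (B : 'M[R]_(r, n)) (D : 'M[R]_r).

(** Multiplying [A *m dB = - dA *m B] by a right inverse of [B] factors [dA]
through [A]; a left inverse of [A] then gives [dB] with the same factor. *)
Lemma motion_mulmx A B dA dB :
  row_full A -> row_free B -> A *m dB + dA *m B = 0 ->
  exists D, dA = A *m D /\ dB = - D *m B.
Proof.
move=> /row_fullP[A' AK] /row_freeP[B' BK] /eqP; rewrite addr_eq0 => /eqP AdB.
pose D := - (dB *m B'); have dAE : dA = A *m D.
  by rewrite mulmxN mulmxA AdB mulNmx opprK -mulmxA BK mulmx1.
exists D; split=> //.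
rewrite -[LHS]mul1mx -AK -mulmxA AdB dAE mulmxN !mulmxA AK mul1mx.
by rewrite -[in LHS]mulNmx.
Qed.

Lemma motion_ge0 p q (M dM : 'M[R]_(p, q)) e :
  0 < e -> (forall t, 0 <= t < e -> M + t *: dM \is a mxOver Num.nneg) ->
  forall i j, M i j = 0 -> 0 <= dM i j.
Proof.
move=> e_gt0 M_ge0 i j Mij0.
have /M_ge0/mxOverP/(_ i j) : 0 <= e / 2 < e.
  by rewrite ltr_pdivrMr // ltr_pMr // ltr1n andbT divr_ge0 // ltW.
by rewrite !mxE Mij0 add0r nnegrE pmulr_rge0 // divr_gt0.
Qed.

Lemma nontrivial_motion_form A B :
  row_full A -> row_free B -> ~ infinitesimally_rigid A B ->
  exists2 D, ~~ is_diag_mx D & forall l, 0 <= (mxvec D *m Z_mx A B) 0 l.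
Proof.
move=> fullA freeB /existsNP[dA] /existsNP[dB] /not_implyP[].
case=> motion [e e_gt0 pos] nontrivial.
have [D [dAE dBE]] := motion_mulmx fullA freeB motion.
exists D; first by apply/negP => D_diag; apply: nontrivial; exists D.
apply/(Z_mx_forms A B D (fun x => 0 <= x)); split=> [i j Aij0|j i Bji0].
  rewrite -dAE; apply: (motion_ge0 e_gt0) Aij0 => t te.
  by case: (pos t te).
have -> : - (D *m B) j i = dB j i by rewrite dBE mulNmx [RHS]mxE.
by apply: (motion_ge0 e_gt0) Bji0 => t te; case: (pos t te).
Qed.

(** Where [M] vanishes, [f] is eventually nonnegative because its difference
quotient [g] has a positive limit; where [M] is positive, because [f] tends to
[M]. *)
Lemma near_nneg p q (M N : 'M[R]_(p, q)) (f g : R -> 'M[R]_(p, q)) :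
  M \is a mxOver Num.nneg ->
  (\forall t \near 0^'+, f t = M + t *: g t) ->
  f t @[t --> 0^'+] --> M -> g t @[t --> 0^'+] --> N ->
  (forall i j, M i j = 0 -> 0 < N i j) ->
  \forall t \near 0^'+, f t \is a mxOver Num.nneg.
Proof.
move=> /mxOverP M_ge0 near_fE fM gN N_gt0.
have entry i j : \forall t \near 0^'+, f t i j \in Num.nneg.
  have := M_ge0 i j; rewrite nnegrE le_eqVlt => /predU1P[Mij0|Mij_gt0].
    have Nij_gt0 := N_gt0 i j (esym Mij0).
    have near_g := cvgr_gt _ (cvg_entry (i := i) (j := j) gN) _ Nij_gt0.
    near=> t; rewrite (_ : f t = M + t *: g t); last by near: t.
    rewrite !mxE -Mij0 add0r nnegrE mulr_ge0 ?ltW //.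
    by near: t; exact: near_g.
  near=> t; rewrite nnegrE ltW //; near: t.
  exact: cvgr_gt _ (cvg_entry (i := i) (j := j) fM) _ Mij_gt0.
have entries : \forall t \near 0^'+, forall i j, f t i j \in Num.nneg.
  by apply: filter_forall => i; apply: filter_forall => j; exact: entry.
by apply: filterS entries => t ft; apply/mxOverP.
Unshelve. all: by end_near. Qed.

(** Along [t |-> (A *m (1 + t D), (1 + t D)^-1 *m B)] all zero entries become
nonnegative, and [A] determines the factor [1 + t D], which is not diagonal. *)
Lemma positive_form_not_locally_rigid A B D :
  row_full A -> A \is a mxOver Num.nneg -> B \is a mxOver Num.nneg ->
  ~~ is_diag_mx D -> (forall l, 0 < (mxvec D *m Z_mx A B) 0 l) ->
  ~ locally_rigid A B.
Proof.
move=> fullA A_ge0 B_ge0 D_ndiag.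
move=> /(Z_mx_forms A B D (fun x => 0 < x))[AD_gt0 DB_gt0] rigid.
pose u t : 'M[R]_r := 1%:M + t *: D.
have cvg_u : u t @[t --> 0^'+] --> (1%:M : 'M[R]_r).
  apply: cvg_entries => i j.
  under eq_cvg => t do rewrite mxE [X in _ + X]mxE.
  exact: cvg_affine_right0.
have u1 : (1%:M : 'M[R]_r) \in unitmx := unitmx1 _ _.
have cvg_v : invmx (u t) @[t --> 0^'+] --> (1%:M : 'M[R]_r).
  by rewrite -(invmx1 R r); exact: cvg_invmx.
have cvg_A : A *m u t @[t --> 0^'+] --> A.
  by rewrite -{2}[A]mulmx1; apply: cvg_mulmx cvg_u; exact: cvg_cst.
have cvg_B : invmx (u t) *m B @[t --> 0^'+] --> B.
  by rewrite -{2}[B]mul1mx; apply: cvg_mulmx cvg_v _; exact: cvg_cst.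
have near_rigid : \forall t \near 0^'+,
    nn_factorization (A *m B) (A *m u t) (invmx (u t) *m B) ->
    exists L : 'M[R]_r, [/\ is_diag_mx L, forall i, 0 < L i i,
      A *m u t = A *m L & invmx (u t) *m B = invmx L *m B].
  have near_AB := cvg_pair cvg_A cvg_B rigid; exact: near_AB.
have unit_u : \forall t \near 0^'+, u t \in unitmx := near_unitmx u1 cvg_u.
have A_near : \forall t \near 0^'+, A *m u t \is a mxOver Num.nneg.
  apply: (near_nneg (N := A *m D)) cvg_A _ AD_gt0 => //; last exact: cvg_cst.
  by near=> t; rewrite mulmxDr mulmx1 scalemxAr.
have B_near : \forall t \near 0^'+, invmx (u t) *m B \is a mxOver Num.nneg.
  have cvg_dB : - (D *m (invmx (u t) *m B)) @[t --> 0^'+] --> - (D *m B).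
    apply: cvg_entries => i j; under eq_cvg do rewrite mxE.
    rewrite mxE; apply: cvgN; apply: cvg_entry.
    by apply: cvg_mulmx cvg_B; exact: cvg_cst.
  apply: (near_nneg B_ge0 _ cvg_B cvg_dB); last first.
    by move=> i j Bij0; rewrite [X in 0 < X]mxE; exact: DB_gt0.
  near=> t; have ut : u t \in unitmx by near: t; exact: unit_u.
  (* An exact first order expansion, from [u t *m invmx (u t) = 1]. *)
  have vE : invmx (u t) = 1%:M - t *: (D *m invmx (u t)).
    by rewrite -(mulmxV ut) [in X in X - _]mulmxDl mul1mx -scalemxAl addrK.
  by rewrite {1}vE mulmxBl mul1mx -scalemxAl scalerN mulmxA.
near (0 : R)^'+ => t.
have t_gt0 : 0 < t by near: t; exact: nbhs_right_gt.
have ut : u t \in unitmx by near: t; exact: unit_u.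
have fact : nn_factorization (A *m B) (A *m u t) (invmx (u t) *m B).
  by split; [near: t|near: t|rewrite mulmxA mulmxK].
have [L [/is_diag_mxP L_diag _ AuE _]] : exists L : 'M[R]_r,
    [/\ is_diag_mx L, forall i, 0 < L i i,
      A *m u t = A *m L & invmx (u t) *m B = invmx L *m B].
  by move: fact; near: t.
have [A' AK] := row_fullP fullA.
have uE : u t = L by rewrite -[LHS]mul1mx -[RHS]mul1mx -AK -!mulmxA AuE.
move/negP: D_ndiag; apply; apply/is_diag_mxP => i j ij.
have := L_diag i j ij; rewrite -uE !mxE.
have -> : (i == j) = false by exact/negbTE.
by rewrite add0r => /eqP; rewrite mulf_eq0 gt_eqF //= => /eqP.
Unshelve. all: by end_near. Qed.

End Rigidity.

(** * The bound on the Kruskal rank *)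

Theorem proposition4p8 (R : realType) (m n r : nat)
  (m_gt0 : (0 < m)%N) (n_gt0 : (0 < n)%N) (r_gt0 : (0 < r)%N)
  (A : 'M[R]_(m, r)) (B : 'M[R]_(r, n))
  (A_ge0 : A \is a mxOver Num.nneg) (B_ge0 : B \is a mxOver Num.nneg)
  (rankAB : \rank (A *m B) = r)
  (loc_rigid : locally_rigid A B)
  (not_inf_rigid : ~ infinitesimally_rigid A B) :
  (Kruskal_rank (Z_mx A B) < minn (size (Z_elems A B)) (r ^ 2 - r))%N.
Proof.
have fullA : row_full A.
  by rewrite /row_full eqn_leq rank_leq_col -{1}rankAB mxrankM_maxl.
have freeB : row_free B.
  by rewrite /row_free eqn_leq rank_leq_row -{1}rankAB mxrankM_maxr.
have [D D_ndiag D_ge0] := nontrivial_motion_form fullA freeB not_inf_rigid.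
rewrite ltnNge; apply/negP => large_rank.
have freeJ := free_zero_forms D_ndiag large_rank.
have [e e_near] := perturb_positive D_ge0 freeJ.
have [i [j [ij Dij]]] : exists i j : 'I_r, i != j :> nat /\ D i j != 0.
  apply: contrapT => noij; move/negP: D_ndiag; apply.
  apply/is_diag_mxP => i j ij; apply/eqP/negPn/negP => Dij.
  by apply: noij; exists i, j.
(* The perturbed matrix must still be non-diagonal, which is not automatic when
   there are no columns at all. *)
have Dij_near : \forall s \near ((0 : R)^'+)%classic,
    (D + s *: vec_mx e) i j != 0.
  have cvg_Dij := @cvg_affine_right0 _ (D i j) (vec_mx e i j).
  by apply: filterS (cvgr_neq0 _ cvg_Dij Dij) => s; rewrite !mxE.
near (0 : R)^'+%classic => s.
apply: (@positive_form_not_locally_rigid _ _ _ _ A B (D + s *: vec_mx e)) => //.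
  have Ds : (D + s *: vec_mx e) i j != 0 by near: s.
  by apply: contra_neqN Ds => /is_diag_mxP ->.
by rewrite linearD linearZ /= vec_mxK; near: s.
Unshelve. all: by end_near. Qed.
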